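(* Let $\mathscr{K}$ be a 2-category and let $p:\mathbf{E}\to\mathbf{B}$ be a 1-cell of $\mathscr{K}$. A comprehension structure with section on $p$ is a comprehension structure on $p$, seen as a morphism $([-],\mathrm{id}_{\mathbf{B}},\iota):(\mathbf{E},\mathbf{B},p)\to(\mathbf{B},\mathbf{B},\mathrm{id}_{\mathbf{B}})$ of the 2-category $\mathscr{K}//\mathscr{K}$, which is right adjoint in the 2-category $\mathscr{K}//\mathscr{K}$ to a section of $p$, seen as a strict morphism $(\star,\mathrm{id}_{\mathbf{B}},\mathrm{id}):(\mathbf{B},\mathbf{B},\mathrm{id}_{\mathbf{B}})\to(\mathbf{E},\mathbf{B},p)$.
   Context: Let $\mathscr{K}$ be a 2-category. The 2-category $\mathscr{K}//\mathscr{K}$ has: - objects: triples $(\mathbf{E},\mathbf{B},p)$ with $p:\mathbf{E}\to\mathbf{B}$ a 1-cell of $\mathscr{K}$; - 1-cells (morphisms) $(\mathbf{E}_1,\mathbf{B}_1,p_1)\to(\mathbf{E}_2,\mathbf{B}_2,p_2)$: triples $(f_{\mathbf{E}},f_{\mathbf{B}},\varphi)$ with $f_{\mathbf{E}}:\mathbf{E}_1\to\mathbf{E}_2$, $f_{\mathbf{B}}:\mathbf{B}_1\to\mathbf{B}_2$ and a 2-cell $\varphi:p_2\circ f_{\mathbf{E}}\Rightarrow f_{\mathbf{B}}\circ p_1$; composition is by pasting; the morphism is called strict when $\varphi$ is an identity; - 2-cells $(f_{\mathbf{E}},f_{\mathbf{B}},\varphi)\Rightarrow(g_{\mathbf{E}},g_{\mathbf{B}},\psi)$: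 pairs $(\theta_{\mathbf{B}},\theta_{\mathbf{E}})$ of 2-cells $\theta_{\mathbf{B}}:f_{\mathbf{B}}\Rightarrow g_{\mathbf{B}}$ and $\theta_{\mathbf{E}}:f_{\mathbf{E}}\Rightarrow g_{\mathbf{E}}$ such that ''$\varphi$ followed by $\theta_{\mathbf{B}}\circ p_1$'' equals ''$p_2\circ\theta_{\mathbf{E}}$ followed by $\psi$'', as 2-cells $p_2\circ f_{\mathbf{E}}\Rightarrow g_{\mathbf{B}}\circ p_1$. An adjunction in a 2-category is a pair of 1-cells with unit and counit 2-cells satisfying the triangular equations. A section of $p:\mathbf{E}\to\mathbf{B}$ is a 1-cell $\star:\mathbf{B}\to\mathbf{E}$ with $p\circ\star=\mathrm{id}_{\mathbf{B}}$; it is the same thing as a strict morphism $(\star,\mathrm{id}_{\mathbf{B}},\mathrm{id}):(\mathbf{B},\mathbf{B},\mathrm{id}_{\mathbf{B}})\to(\mathbf{E},\mathbf{B},p)$. A comprehension structure on $p$ is a pair $([-],\iota)$ of a 1-cell $[-]:\mathbf{E}\to\mathbf{B}$ and a 2-cell $\iota:[-]\Rightarrow p$; it is the same thing as a morphism $([-],\mathrm{id}_{\mathbf{B}},\iota):(\mathbf{E},\mathbf{B},p)\to(\mathbf{B},\mathbf{B},\mathrm{id}_{\mathbf{B}})$ of $\mathscr{K}//\mathscr{K}$. A comprehension structure with section on $p$ is a section $\star:\mathbf{B}\to\mathbf{E}$ of $p$ together with a right adjoint $[-]:\mathbf{E}\to\mathbf{B}$ of $\star$ in the 2-category $\mathscr{K}$.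 *)

(* Defs.v *)
From mathcomp Require Import ssreflect ssrfun.
From Stdlib Require Import ProofIrrelevance.

Set Implicit Arguments.
Unset Strict Implicit.
Unset Printing Implicit Defensive.

(* The identity [id f], seen as a cell from [f] to [g] when [f = g].  The laws
   of a strict 2-category equate 1-cells that are not convertible, so that
   equations between 2-cells need such casts to be well typed. *)
Definition cast_id (T : Type) (cell : T -> T -> Type)
    (id : forall f, cell f f) (f g : T) (e : f = g) : cell f g :=
  match e with erefl => id f end.

(* Strict 2-categories.  1-cells compose in applicative order and 2-cells in
   diagrammatic order: [vcomp alpha beta] is alpha followed by beta.  The last
   three laws say that horizontal composition of 2-cells is strictly
   associative and unital. *)
Record two_category := TwoCategory {
  ob :> Type;
  hom : ob -> ob -> Type;
  cell : forall a b, hom a b -> hom a b -> Type;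
  id1 : forall a, hom a a;
  comp1 : forall a b c, hom b c -> hom a b -> hom a c;
  id2 : forall a b (f : hom a b), cell f f;
  vcomp : forall a b (f g h : hom a b), cell f g -> cell g h -> cell f h;
  hcomp : forall a b c (g g' : hom b c) (f f' : hom a b),
    cell g g' -> cell f f' -> cell (comp1 g f) (comp1 g' f');
  comp1A : forall a b c d (h : hom c d) (g : hom b c) (f : hom a b),
    comp1 h (comp1 g f) = comp1 (comp1 h g) f;
  comp1Il : forall a b (f : hom a b), comp1 (id1 b) f = f;
  comp1Ir : forall a b (f : hom a b), comp1 f (id1 a) = f;
  vcompA : forall a b (f g h k : hom a b)
    (x : cell f g) (y : cell g h) (z : cell h k),
    vcomp x (vcomp y z) = vcomp (vcomp x y) z;
  vcompIl : forall a b (f g : hom a b) (x : cell f g), vcomp (id2 f) x = x;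
  vcompIr : forall a b (f g : hom a b) (x : cell f g), vcomp x (id2 g) = x;
  hcomp_id : forall a b c (g : hom b c) (f : hom a b),
    hcomp (id2 g) (id2 f) = id2 (comp1 g f);
  interchange : forall a b c (g g' g'' : hom b c) (f f' f'' : hom a b)
    (y : cell g g') (y' : cell g' g'') (x : cell f f') (x' : cell f' f''),
    hcomp (vcomp y y') (vcomp x x') = vcomp (hcomp y x) (hcomp y' x');
  hcompA : forall a b c d (h h' : hom c d) (g g' : hom b c) (f f' : hom a b)
    (z : cell h h') (y : cell g g') (x : cell f f'),
    vcomp (hcomp z (hcomp y x)) (cast_id (@id2 a d) (comp1A h' g' f')) =
    vcomp (cast_id (@id2 a d) (comp1A h g f)) (hcomp (hcomp z y) x);
  hcompIl : forall a b (f f' : hom a b) (x : cell f f'),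
    vcomp (hcomp (id2 (id1 b)) x) (cast_id (@id2 a b) (comp1Il f')) =
    vcomp (cast_id (@id2 a b) (comp1Il f)) x;
  hcompIr : forall a b (f f' : hom a b) (x : cell f f'),
    vcomp (hcomp x (id2 (id1 a))) (cast_id (@id2 a b) (comp1Ir f')) =
    vcomp (cast_id (@id2 a b) (comp1Ir f)) x
}.

Arguments hom {t} a b.
Arguments cell {t a b} f g.
Arguments id1 {t} a.
Arguments comp1 {t a b c} g f.
Arguments id2 {t a b} f.
Arguments vcomp {t a b f g h} x y.
Arguments hcomp {t a b c g g' f f'} y x.
Arguments comp1A {t a b c d} h g f.
Arguments comp1Il {t a b} f.
Arguments comp1Ir {t a b} f.

Declare Scope two_category_scope.
Delimit Scope two_category_scope with K.
Local Open Scope two_category_scope.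

Notation "a ~> b" := (hom a b) (at level 70, no associativity) :
  two_category_scope.
Notation "f ==> g" := (cell f g) (at level 70, no associativity) : two_category_scope.
Notation "g ** f" := (comp1 g f) (at level 40, left associativity) :
  two_category_scope.
Notation "x ;; y" := (vcomp x y) (at level 50, left associativity) :
  two_category_scope.
Notation "g *< x" := (hcomp (id2 g) x) (at level 40, left associativity) :
  two_category_scope.
Notation "y >* f" := (hcomp y (id2 f)) (at level 40, left associativity) :
  two_category_scope.

Definition eqcell (K : two_category) (a b : K) (f g : a ~> b) (e : f = g) :
  f ==> g := cast_id (@id2 K a b) e.

(* A 2-cell "is an identity" when its source and target are equal and it is
   the identity up to this equality. *)
Definition is_identity (K : two_category) (a b : K) (f g : a ~> b)
  (x : f ==> g) : Prop := exists e : f = g, x = eqcell e.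

Section Adjunctions.
Context (K : two_category).

Record adjunction (a b : K) (l : a ~> b) (r : b ~> a) := Adjunction {
  adj_unit : id1 a ==> r ** l;
  adj_counit : l ** r ==> id1 b;
  triangle_l :
    eqcell (esym (comp1Ir l)) ;; (l *< adj_unit) ;; eqcell (comp1A l r l) ;;
      (adj_counit >* l) ;; eqcell (comp1Il l) = id2 l;
  triangle_r :
    eqcell (esym (comp1Il r)) ;; (adj_unit >* r) ;; eqcell (esym (comp1A r l r)) ;;
      (r *< adj_counit) ;; eqcell (comp1Ir r) = id2 r
}.

End Adjunctions.

(* Equality of 2-cells whose boundaries are only propositionally equal. *)
Section CellEquality.
Context (K : two_category).
Implicit Types a b c d : K.

Definition ceq a b (f g f' g' : a ~> b) (x : f ==> g) (y : f' ==> g') : Prop :=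
  exists (e : f = f') (e' : g = g'), x ;; eqcell e' = eqcell e ;; y.

Lemma eqcell_refl a b (f : a ~> b) (e : f = f) : eqcell e = id2 f.
Proof. by rewrite (proof_irrelevance _ e erefl). Qed.

Lemma ceq_refl a b (f g : a ~> b) (x : f ==> g) : ceq x x.
Proof. by exists erefl, erefl; rewrite !eqcell_refl vcompIl vcompIr. Qed.

Lemma ceq_of_eq a b (f g : a ~> b) (x y : f ==> g) : x = y -> ceq x y.
Proof. by move=> ->; apply: ceq_refl. Qed.

Lemma eq_of_ceq a b (f g : a ~> b) (x y : f ==> g) : ceq x y -> x = y.
Proof. by case=> e [e']; rewrite !eqcell_refl vcompIl vcompIr. Qed.

Lemma ceq_sym a b (f g f' g' : a ~> b) (x : f ==> g) (y : f' ==> g') :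
  ceq x y -> ceq y x.
Proof.
case=> e [e']; destruct e, e'; rewrite !eqcell_refl vcompIl vcompIr => ->.
exact: ceq_refl.
Qed.

Lemma ceq_trans a b (f g f' g' f'' g'' : a ~> b)
  (x : f ==> g) (y : f' ==> g') (z : f'' ==> g'') :
  ceq x y -> ceq y z -> ceq x z.
Proof.
by case=> e [e']; destruct e, e'; rewrite !eqcell_refl vcompIl vcompIr => ->.
Qed.

Lemma ceq_vcomp a b (f g h f' g' h' : a ~> b) (x : f ==> g) (y : g ==> h)
  (x' : f' ==> g') (y' : g' ==> h') :
  ceq x x' -> ceq y y' -> ceq (x ;; y) (x' ;; y').
Proof.
case=> e1 [e2]; destruct e1, e2; rewrite !eqcell_refl vcompIl vcompIr => ->.
case=> e3 [e4]; destruct e4; rewrite !eqcell_refl vcompIl vcompIr => ->.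
exact: ceq_refl.
Qed.

Lemma ceq_hcomp a b c (g g1 g' g1' : b ~> c) (f f1 f' f1' : a ~> b)
  (y : g ==> g1) (x : f ==> f1) (y' : g' ==> g1') (x' : f' ==> f1') :
  ceq y y' -> ceq x x' -> ceq (hcomp y x) (hcomp y' x').
Proof.
case=> e1 [e2]; destruct e1, e2; rewrite !eqcell_refl vcompIl vcompIr => ->.
case=> e3 [e4]; destruct e3, e4; rewrite !eqcell_refl vcompIl vcompIr => ->.
exact: ceq_refl.
Qed.

Lemma ceq_castl a b (f f' g : a ~> b) (e : f' = f) (x : f ==> g) :
  ceq (eqcell e ;; x) x.
Proof. by destruct e; rewrite !eqcell_refl vcompIl; apply: ceq_refl. Qed.

Lemma ceq_castr a b (f g g' : a ~> b) (e : g = g') (x : f ==> g) :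
  ceq (x ;; eqcell e) x.
Proof. by destruct e; rewrite !eqcell_refl vcompIr; apply: ceq_refl. Qed.

Lemma ceq_hcompA a b c d (h h' : c ~> d) (g g' : b ~> c) (f f' : a ~> b)
  (z : h ==> h') (y : g ==> g') (x : f ==> f') :
  ceq (hcomp z (hcomp y x)) (hcomp (hcomp z y) x).
Proof. by exists (comp1A h g f), (comp1A h' g' f'); apply: hcompA. Qed.

Lemma ceq_hcompIl a b (f f' : a ~> b) (x : f ==> f') :
  ceq (id1 b *< x) x.
Proof. by exists (comp1Il f), (comp1Il f'); apply: hcompIl. Qed.

Lemma ceq_hcompIr a b (f f' : a ~> b) (x : f ==> f') :
  ceq (x >* id1 a) x.
Proof. by exists (comp1Ir f), (comp1Ir f'); apply: hcompIr. Qed.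

Lemma whisk_eqcell a b c (g : b ~> c) (f f' : a ~> b) (e : f = f') :
  g *< eqcell e = eqcell (f_equal (comp1 g) e).
Proof. by destruct e; apply: hcomp_id. Qed.

Lemma eqcell_whisk a b c (g g' : b ~> c) (f : a ~> b) (e : g = g') :
  eqcell e >* f = eqcell (f_equal (fun k => comp1 k f) e).
Proof. by destruct e; apply: hcomp_id. Qed.

Lemma whisk_vcomp a b c (g : b ~> c) (f f' f'' : a ~> b)
  (x : f ==> f') (y : f' ==> f'') : g *< (x ;; y) = (g *< x) ;; (g *< y).
Proof. by rewrite -interchange vcompIl. Qed.

Lemma vcomp_whisk a b c (g g' g'' : b ~> c) (f : a ~> b)
  (x : g ==> g') (y : g' ==> g'') : (x ;; y) >* f = (x >* f) ;; (y >* f).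
Proof. by rewrite -interchange vcompIl. Qed.

(* Vertical composition across an equality of 1-cells. *)
Definition vcompc a b (f g g' h : a ~> b) (e : g = g')
  (x : f ==> g) (y : g' ==> h) : f ==> h := x ;; eqcell e ;; y.

Lemma ceq_vcompc a b (f g g1 h f' g' g1' h' : a ~> b)
  (e : g = g1) (e' : g' = g1')
  (x : f ==> g) (y : g1 ==> h) (x' : f' ==> g') (y' : g1' ==> h') :
  ceq x x' -> ceq y y' -> ceq (vcompc e x y) (vcompc e' x' y').
Proof.
by destruct e, e' => xx yy; rewrite /vcompc !eqcell_refl !vcompIr; apply: ceq_vcomp.
Qed.

Lemma vcompc_whisk a b c (g g1 g' g1' : b ~> c) (f : a ~> b) (e : g1 = g')
  (x : g ==> g1) (y : g' ==> g1') :
  vcompc e x y >* f =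
    vcompc (f_equal (fun k => comp1 k f) e) (x >* f) (y >* f).
Proof. by destruct e; rewrite /vcompc !eqcell_refl !vcompIr vcomp_whisk. Qed.

Lemma whisk_vcompc a b c (g : b ~> c) (f f1 f' f1' : a ~> b) (e : f1 = f')
  (x : f ==> f1) (y : f' ==> f1') :
  g *< vcompc e x y = vcompc (f_equal (comp1 g) e) (g *< x) (g *< y).
Proof. by destruct e; rewrite /vcompc !eqcell_refl !vcompIr whisk_vcomp. Qed.

Lemma ceq_vcompcA a b (f g g' h h' k : a ~> b) (e : g = g') (e' : h = h')
  (x : f ==> g) (y : g' ==> h) (z : h' ==> k) :
  ceq (vcompc e x (vcompc e' y z)) (vcompc e' (vcompc e x y) z).
Proof.
by destruct e, e'; rewrite /vcompc !eqcell_refl !vcompIr vcompA; apply: ceq_refl.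
Qed.

End CellEquality.

(* The 2-category K//K: an object (E, B, p) is [Arrow p] with [top] E and
   [base] B, a 1-cell (f_E, f_B, phi) is [AMor phi], and [ctop], [cbase] are the
   components theta_E, theta_B of a 2-cell. *)
Section ArrowTwoCategory.
Context (K : two_category).

Record arrow := Arrow {
  top : K;
  base : K;
  arr : top ~> base
}.

Record amor (p1 p2 : arrow) := AMor {
  mtop : top p1 ~> top p2;
  mbase : base p1 ~> base p2;
  mcell : arr p2 ** mtop ==> mbase ** arr p1
}.

Record acell (p1 p2 : arrow) (f g : amor p1 p2) := ACell {
  ctop : mtop f ==> mtop g;
  cbase : mbase f ==> mbase g;
  ccell : mcell f ;; (cbase >* arr p1) = (arr p2 *< ctop) ;; mcell g
}.

Definition aid1 (p : arrow) : amor p p :=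
  AMor (eqcell (etrans (comp1Ir (arr p)) (esym (comp1Il (arr p))))).

(* Pasting: [mcell g] whiskered by [mtop f], then [mcell f] whiskered by
   [mbase g], up to associativity. *)
Definition acomp (p1 p2 p3 : arrow) (g : amor p2 p3) (f : amor p1 p2) :
    amor p1 p3 :=
  @AMor p1 p3 (mtop g ** mtop f) (mbase g ** mbase f)
    (eqcell (comp1A (arr p3) (mtop g) (mtop f)) ;;
     (mcell g >* mtop f) ;;
     eqcell (esym (comp1A (mbase g) (arr p2) (mtop f))) ;;
     (mbase g *< mcell f) ;;
     eqcell (comp1A (mbase g) (mbase f) (arr p1))).

Lemma ceq_acomp (p1 p2 p3 : arrow) (g : amor p2 p3) (f : amor p1 p2) :
  ceq (mcell (acomp g f))
    (vcompc (esym (comp1A (mbase g) (arr p2) (mtop f)))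
      (mcell g >* mtop f) (mbase g *< mcell f)).
Proof.
apply: ceq_trans (ceq_castr _ _) _; rewrite -!vcompA.
by apply: ceq_trans (ceq_castl _ _) _; rewrite /vcompc vcompA; apply: ceq_refl.
Qed.

Lemma amor_eq (p1 p2 : arrow) (f g : amor p1 p2) :
  mtop f = mtop g -> mbase f = mbase g -> ceq (mcell f) (mcell g) -> f = g.
Proof.
case: f g => [ft fb fc] [gt gb gc] /= et eb; destruct et, eb.
by move/eq_of_ceq => ->.
Qed.

Lemma acell_eq (p1 p2 : arrow) (f g : amor p1 p2) (x y : acell f g) :
  ctop x = ctop y -> cbase x = cbase y -> x = y.
Proof.
case: x y => [xt xb xc] [yt yb yc] /= et eb; destruct et, eb.
by rewrite (proof_irrelevance _ xc yc).
Qed.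

Lemma aid2_subproof (p1 p2 : arrow) (f : amor p1 p2) :
  mcell f ;; (id2 (mbase f) >* arr p1) = (arr p2 *< id2 (mtop f)) ;; mcell f.
Proof. by rewrite !hcomp_id vcompIl vcompIr. Qed.

Definition aid2 (p1 p2 : arrow) (f : amor p1 p2) : acell f f :=
  ACell (aid2_subproof f).

Lemma avcomp_subproof (p1 p2 : arrow) (f g h : amor p1 p2)
    (x : acell f g) (y : acell g h) :
  mcell f ;; ((cbase x ;; cbase y) >* arr p1) =
    (arr p2 *< (ctop x ;; ctop y)) ;; mcell h.
Proof.
by rewrite vcomp_whisk whisk_vcomp vcompA ccell -vcompA ccell vcompA.
Qed.

Definition avcomp (p1 p2 : arrow) (f g h : amor p1 p2)
    (x : acell f g) (y : acell g h) : acell f h :=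
  ACell (avcomp_subproof x y).

Lemma ahcomp_subproof (p1 p2 p3 : arrow) (g g' : amor p2 p3)
    (f f' : amor p1 p2) (y : acell g g') (x : acell f f') :
  mcell (acomp g f) ;; (hcomp (cbase y) (cbase x) >* arr p1) =
    (arr p3 *< hcomp (ctop y) (ctop x)) ;; mcell (acomp g' f').
Proof.
have eb : ceq (mcell (acomp g f) ;; (hcomp (cbase y) (cbase x) >* arr p1))
    (vcompc (esym (comp1A (mbase g) (arr p2) (mtop f)))
      (mcell g >* mtop f)
      (hcomp (cbase y) (mcell f ;; (cbase x >* arr p1)))).
  rewrite -(vcompIl (cbase y)) interchange vcompIl /vcompc vcompA.
  set e := comp1A (mbase g) (mbase f) (arr p1).
  have -> : mcell (acomp g f) ;; (hcomp (cbase y) (cbase x) >* arr p1) =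
     eqcell (comp1A (arr p3) (mtop g) (mtop f)) ;; 
       ((mcell g >* mtop f) ;;
       eqcell (esym (comp1A (mbase g) (arr p2) (mtop f))) ;;
       (mbase g *< mcell f) ;;
       (eqcell e ;; (hcomp (cbase y) (cbase x) >* arr p1))).
    by rewrite /= !vcompA.
  apply: ceq_trans (ceq_castl _ _) _; apply: ceq_vcomp; first exact: ceq_refl.
  by apply: ceq_trans (ceq_castl _ _) _; apply/ceq_sym/ceq_hcompA.
have et : ceq ((arr p3 *< hcomp (ctop y) (ctop x)) ;; mcell (acomp g' f'))
    (vcompc (esym (comp1A (mbase g') (arr p2) (mtop f')))
      (hcomp ((arr p3 *< ctop y) ;; mcell g') (ctop x))
      (mbase g' *< mcell f')).
  have eg : (arr p3 *< hcomp (ctop y) (ctop x)) ;; mcell (acomp g' f') =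
     ((arr p3 *< hcomp (ctop y) (ctop x)) ;;
       eqcell (comp1A (arr p3) (mtop g') (mtop f'))) ;;
       (mcell g' >* mtop f') ;;
       eqcell (esym (comp1A (mbase g') (arr p2) (mtop f'))) ;;
       (mbase g' *< mcell f') ;;
       eqcell (comp1A (mbase g') (mbase f') (arr p1)).
    by rewrite /= !vcompA.
  rewrite eg; apply: ceq_trans (ceq_castr _ _) _.
  rewrite /vcompc; do 2 (apply: ceq_vcomp; last exact: ceq_refl).
  rewrite -{2}(vcompIr (ctop x)) interchange.
  apply: ceq_vcomp; last exact: ceq_refl.
  by apply: ceq_trans (ceq_castr _ _) _; apply: ceq_hcompA.
apply: eq_of_ceq; apply: ceq_trans eb _; apply: ceq_sym; apply: ceq_trans et _.
rewrite -(ccell y) (ccell x).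
have -> : hcomp (mcell g ;; (cbase y >* arr p2)) (ctop x) =
    (mcell g >* mtop f) ;; hcomp (cbase y >* arr p2) (ctop x).
  by rewrite -interchange vcompIl.
have -> : hcomp (cbase y) ((arr p2 *< ctop x) ;; mcell f') =
    hcomp (cbase y) (arr p2 *< ctop x) ;; (mbase g' *< mcell f').
  by rewrite -interchange vcompIr.
rewrite /vcompc -!vcompA; apply: ceq_vcomp; first exact: ceq_refl.
rewrite !vcompA; apply: ceq_vcomp; last exact: ceq_refl.
apply: ceq_trans (ceq_castr _ _) _; apply: ceq_sym.
by apply: ceq_trans (ceq_castl _ _) _; apply: ceq_hcompA.
Qed.

Definition ahcomp (p1 p2 p3 : arrow) (g g' : amor p2 p3)
    (f f' : amor p1 p2) (y : acell g g') (x : acell f f') :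
    acell (acomp g f) (acomp g' f') :=
  @ACell p1 p3 (acomp g f) (acomp g' f')
    (hcomp (ctop y) (ctop x)) (hcomp (cbase y) (cbase x)) (ahcomp_subproof y x).

Lemma acompA (p1 p2 p3 p4 : arrow) (h : amor p3 p4) (g : amor p2 p3)
    (f : amor p1 p2) : acomp h (acomp g f) = acomp (acomp h g) f.
Proof.
apply: amor_eq; [exact: comp1A | exact: comp1A |].
apply: ceq_trans (ceq_acomp _ _) _.
have e1 : mbase h ** arr p3 ** mtop (acomp g f) =
    mbase h ** (arr p3 ** mtop g ** mtop f) by rewrite /= !comp1A.
apply: ceq_trans.
  apply: (ceq_vcompc _ e1); first exact: ceq_refl.
  exact: ceq_hcomp (ceq_refl _) (ceq_acomp _ _).
rewrite whisk_vcompc; apply: ceq_trans (ceq_vcompcA _ _ _ _ _) _.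
apply: ceq_sym; apply: ceq_trans (ceq_acomp _ _) _.
have e2 : mbase h ** (mbase g ** arr p2) ** mtop f =
    mbase (acomp h g) ** (arr p2 ** mtop f) by rewrite /= !comp1A.
apply: ceq_trans.
  apply: (ceq_vcompc _ e2); last exact: ceq_refl.
  exact: ceq_hcomp (ceq_acomp _ _) (ceq_refl _).
rewrite vcompc_whisk; apply: ceq_vcompc.
  apply: ceq_vcompc; last exact/ceq_sym/ceq_hcompA.
  by rewrite /= -hcomp_id; apply/ceq_sym/ceq_hcompA.
by rewrite /= -hcomp_id; apply/ceq_sym/ceq_hcompA.
Qed.

Lemma acompIl (p1 p2 : arrow) (f : amor p1 p2) : acomp (aid1 p2) f = f.
Proof.
apply: amor_eq; [exact: comp1Il | exact: comp1Il |].
apply: ceq_trans (ceq_acomp _ _) _; rewrite /= eqcell_whisk /vcompc -vcompA.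
apply: ceq_trans (ceq_castl _ _) _; apply: ceq_trans (ceq_castl _ _) _.
exact: ceq_hcompIl.
Qed.

Lemma acompIr (p1 p2 : arrow) (f : amor p1 p2) : acomp f (aid1 p1) = f.
Proof.
apply: amor_eq; [exact: comp1Ir | exact: comp1Ir |].
apply: ceq_trans (ceq_acomp _ _) _; rewrite /= whisk_eqcell /vcompc.
apply: ceq_trans (ceq_castr _ _) _; apply: ceq_trans (ceq_castr _ _) _.
exact: ceq_hcompIr.
Qed.

Lemma avcompA (p1 p2 : arrow) (f g h k : amor p1 p2)
  (x : acell f g) (y : acell g h) (z : acell h k) :
  avcomp x (avcomp y z) = avcomp (avcomp x y) z.
Proof. by apply: acell_eq; apply: vcompA. Qed.

Lemma avcompIl (p1 p2 : arrow) (f g : amor p1 p2) (x : acell f g) :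
  avcomp (aid2 f) x = x.
Proof. by apply: acell_eq; apply: vcompIl. Qed.

Lemma avcompIr (p1 p2 : arrow) (f g : amor p1 p2) (x : acell f g) :
  avcomp x (aid2 g) = x.
Proof. by apply: acell_eq; apply: vcompIr. Qed.

Lemma ahcomp_id (p1 p2 p3 : arrow) (g : amor p2 p3) (f : amor p1 p2) :
  ahcomp (aid2 g) (aid2 f) = aid2 (acomp g f).
Proof. by apply: acell_eq; apply: hcomp_id. Qed.

Lemma ainterchange (p1 p2 p3 : arrow) (g g' g'' : amor p2 p3)
  (f f' f'' : amor p1 p2) (y : acell g g') (y' : acell g' g'')
  (x : acell f f') (x' : acell f' f'') :
  ahcomp (avcomp y y') (avcomp x x') = avcomp (ahcomp y x) (ahcomp y' x').
Proof. by apply: acell_eq; apply: interchange. Qed.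

Lemma ctop_cast (p1 p2 : arrow) (f g : amor p1 p2) (e : f = g) :
  ctop (cast_id (@aid2 p1 p2) e) = eqcell (f_equal (@mtop p1 p2) e).
Proof. by destruct e. Qed.

Lemma cbase_cast (p1 p2 : arrow) (f g : amor p1 p2) (e : f = g) :
  cbase (cast_id (@aid2 p1 p2) e) = eqcell (f_equal (@mbase p1 p2) e).
Proof. by destruct e. Qed.

Lemma ahcompA (p1 p2 p3 p4 : arrow) (h h' : amor p3 p4) (g g' : amor p2 p3)
  (f f' : amor p1 p2) (z : acell h h') (y : acell g g') (x : acell f f') :
  avcomp (ahcomp z (ahcomp y x)) (cast_id (@aid2 p1 p4) (acompA h' g' f')) =
  avcomp (cast_id (@aid2 p1 p4) (acompA h g f)) (ahcomp (ahcomp z y) x).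
Proof.
apply: acell_eq; rewrite /= ?ctop_cast ?cbase_cast; apply: eq_of_ceq;
  apply: ceq_trans (ceq_castr _ _) _; apply/ceq_sym;
  by apply: ceq_trans (ceq_castl _ _) _; apply/ceq_sym/ceq_hcompA.
Qed.

Lemma ahcompIl (p1 p2 : arrow) (f f' : amor p1 p2) (x : acell f f') :
  avcomp (ahcomp (aid2 (aid1 p2)) x) (cast_id (@aid2 p1 p2) (acompIl f')) =
  avcomp (cast_id (@aid2 p1 p2) (acompIl f)) x.
Proof.
apply: acell_eq; rewrite /= ?ctop_cast ?cbase_cast; apply: eq_of_ceq;
  apply: ceq_trans (ceq_castr _ _) _; apply/ceq_sym;
  by apply: ceq_trans (ceq_castl _ _) _; apply/ceq_sym/ceq_hcompIl.
Qed.

Lemma ahcompIr (p1 p2 : arrow) (f f' : amor p1 p2) (x : acell f f') :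
  avcomp (ahcomp x (aid2 (aid1 p1))) (cast_id (@aid2 p1 p2) (acompIr f')) =
  avcomp (cast_id (@aid2 p1 p2) (acompIr f)) x.
Proof.
apply: acell_eq; rewrite /= ?ctop_cast ?cbase_cast; apply: eq_of_ceq;
  apply: ceq_trans (ceq_castr _ _) _; apply/ceq_sym;
  by apply: ceq_trans (ceq_castl _ _) _; apply/ceq_sym/ceq_hcompIr.
Qed.

Definition arrow_two_category : two_category :=
  @TwoCategory arrow amor acell aid1 acomp aid2 avcomp ahcomp
    acompA acompIl acompIr avcompA avcompIl avcompIr ahcomp_id ainterchange
    ahcompA ahcompIl ahcompIr.

End ArrowTwoCategory.

Section Comprehensions.
Context (K : two_category) (E B : K) (p : E ~> B).

Record section_of := SectionOf {
  sec : B ~> E;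
  secP : p ** sec = id1 B
}.

Record comprehension := Comprehension {
  bracket : E ~> B;
  iota : bracket ==> p
}.

Record comprehension_with_section := ComprehensionWithSection {
  cws_section : section_of;
  cws_bracket : E ~> B;
  cws_adj : adjunction (sec cws_section) cws_bracket
}.

Definition arrow_of : arrow_two_category K := Arrow p.

Definition arrow_id : arrow_two_category K := Arrow (id1 B).

(* A section as a strict morphism: the 2-cell [p ** sec s ==> id1 B ** id1 B]
   is an identity. *)
Definition section_mor (s : section_of) : arrow_id ~> arrow_of :=
  @AMor K arrow_id arrow_of (sec s) (id1 B)
    (eqcell (etrans (secP s) (esym (comp1Il (id1 B))))).

(* The 2-cell is [iota c], up to the equalities [id1 B ** bracket c = bracket c]
   and [p = id1 B ** p]. *)
Definition comprehension_mor (c : comprehension) : arrow_of ~> arrow_id :=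
  @AMor K arrow_of arrow_id (bracket c) (id1 B)
    (eqcell (comp1Il (bracket c)) ;; iota c ;; eqcell (esym (comp1Il p))).

Record comprehension_adjoint_to_section := ComprehensionAdjointToSection {
  cas_section : section_of;
  cas_comprehension : comprehension;
  cas_adj :
    adjunction (section_mor cas_section) (comprehension_mor cas_comprehension)
}.

(* [Y] is the image of [X] under the 2-functor from K//K to K sending
   (E, B, p) to E: same section, same 1-cell E ~> B, and the unit and counit
   of [Y] are the E-components of those of [X]. *)
Definition underlies (X : comprehension_adjoint_to_section)
    (Y : comprehension_with_section) : Prop :=
  exists tl tr, Y = @ComprehensionWithSection
    (cas_section X) (bracket (cas_comprehension X))
    (Adjunction (adj_unit := ctop (adj_unit (cas_adj X)))
      (adj_counit := ctop (adj_counit (cas_adj X))) tl tr).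

(* The B-components of the unit and counit of [X], which are 2-cells
   id1 B ==> id1 B ** id1 B and id1 B ** id1 B ==> id1 B, are identities.
   The adjunction in K does not determine them: in general they are an
   arbitrary invertible 2-cell of [id1 B] and its inverse. *)
Definition vertical (X : comprehension_adjoint_to_section) : Prop :=
  is_identity (cbase (adj_unit (cas_adj X))) /\
  is_identity (cbase (adj_counit (cas_adj X))).

End Comprehensions.

(* Main.v *)
(* The 2-functors top, base : K//K -> K preserve adjunctions and are jointly
   faithful on 2-cells, so an adjunction in K//K is the same thing as a pair of
   adjunctions in K whose units and counits satisfy the compatibility [ccell].
   When the base components are identities, compatibility of the counit [eps]
   says exactly that [iota] is [p *< eps] up to the equality
   [r = p ** (sec ** r)]; compatibility of the unit is then the image under [p]
   of the first triangular equation. *)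
From mathcomp Require Import ssreflect ssrfun.
From Stdlib Require Import ProofIrrelevance.
Require Import Defs.

Set Implicit Arguments.
Unset Strict Implicit.
Unset Printing Implicit Defensive.

Local Open Scope two_category_scope.

(** * Identity 2-cells between propositionally equal 1-cells *)

Section Identities.
Context (K : two_category).

Lemma is_identity_eqcell (a b : K) (f g : a ~> b) (e : f = g) :
  is_identity (eqcell e).
Proof. by exists e. Qed.

Lemma is_identity_vcomp (a b : K) (f g h : a ~> b) (x : f ==> g) (y : g ==> h) :
  is_identity x -> is_identity y -> is_identity (x ;; y).
Proof.
by case=> e -> [e' ->]; exists (etrans e e'); destruct e, e'; apply: vcompIl.
Qed.

Lemma is_identity_whiskl (a b c : K) (g : b ~> c) (f f' : a ~> b)
  (x : f ==> f') : is_identity x -> is_identity (g *< x).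
Proof. by case=> e ->; exists (f_equal (comp1 g) e); apply: whisk_eqcell. Qed.

Lemma is_identity_whiskr (a b c : K) (g g' : b ~> c) (f : a ~> b)
  (x : g ==> g') : is_identity x -> is_identity (x >* f).
Proof.
by case=> e ->; exists (f_equal (comp1^~ f) e); apply: eqcell_whisk.
Qed.

Lemma is_identity_id2 (a b : K) (f : a ~> b) (x : f ==> f) :
  is_identity x -> x = id2 f.
Proof. by case=> e ->; apply: eqcell_refl. Qed.

Lemma is_identity_eq (a b : K) (f g : a ~> b) (x y : f ==> g) :
  is_identity x -> is_identity y -> x = y.
Proof. by case=> e -> [e' ->]; rewrite (proof_irrelevance _ e e'). Qed.

Lemma ceq_is_identity (a b : K) (f f' g : a ~> b) (x : f ==> f') :
  is_identity x -> f = g -> ceq x (id2 g).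
Proof. by case=> e -> e'; destruct e, e'; apply: ceq_refl. Qed.

Lemma ceq_identityl (a b : K) (f f' g : a ~> b) (y : f ==> f') (x : f' ==> g) :
  is_identity y -> ceq (y ;; x) x.
Proof. by case=> e ->; apply: ceq_castl. Qed.

Lemma ceq_identityr (a b : K) (f g g' : a ~> b) (y : g ==> g') (x : f ==> g) :
  is_identity y -> ceq (x ;; y) x.
Proof. by case=> e ->; apply: ceq_castr. Qed.

Lemma vcompc_refl (a b : K) (f g h : a ~> b) (x : f ==> g) (y : g ==> h) :
  vcompc erefl x y = x ;; y.
Proof. by rewrite /vcompc vcompIr. Qed.

End Identities.

(** * The two composites occurring in the triangular equations *)

Section Zigzags.
Context (K : two_category) (a b : K) (l : a ~> b) (r : b ~> a).
Context (u : id1 a ==> r ** l) (c : l ** r ==> id1 b).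

(** Formed for an arbitrary pair of 2-cells, so that it can be computed before any triangular
    equation is known. *)
Definition zigzag_l : l ==> l :=
  eqcell (esym (comp1Ir l)) ;; (l *< u) ;; eqcell (comp1A l r l) ;;
    (c >* l) ;; eqcell (comp1Il l).

Definition zigzag_r : r ==> r :=
  eqcell (esym (comp1Il r)) ;; (u >* r) ;; eqcell (esym (comp1A r l r)) ;;
    (r *< c) ;; eqcell (comp1Ir r).

(** Every factor is an identity, hence so is the composite, and an identity from [l] to itself is
    [id2 l] by proof irrelevance. *)
Lemma is_identity_zigzag_l : is_identity u -> is_identity c -> zigzag_l = id2 l.
Proof.
move=> iu ic; apply: is_identity_id2.
by do !apply: is_identity_vcomp; try exact: is_identity_eqcell;
  [apply: is_identity_whiskl | apply: is_identity_whiskr].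
Qed.

Lemma is_identity_zigzag_r : is_identity u -> is_identity c -> zigzag_r = id2 r.
Proof.
move=> iu ic; apply: is_identity_id2.
by do !apply: is_identity_vcomp; try exact: is_identity_eqcell;
  [apply: is_identity_whiskr | apply: is_identity_whiskl].
Qed.

End Zigzags.

Lemma adjunction_eq (K : two_category) (a b : K) (l : a ~> b) (r : b ~> a)
  (x y : adjunction l r) :
  adj_unit x = adj_unit y -> adj_counit x = adj_counit y -> x = y.
Proof.
case: x y => [u c tl tr] [u' c' tl' tr'] /= eu ec; destruct eu, ec.
by rewrite (proof_irrelevance _ tl tl') (proof_irrelevance _ tr tr').
Qed.

(** * Preservation of adjunctions by the projections from K//K to K *)

Section Projections.
Context (K : two_category) (a b : arrow_two_category K).
Context (l : a ~> b) (r : b ~> a).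
Context (u : id1 a ==> r ** l) (c : l ** r ==> id1 b).

(** The projection is strict on all operations, so the two sides can differ only in the equality
    proofs inside the casts. *)
Lemma ctop_zigzag_l :
  ctop (zigzag_l u c) = @zigzag_l K _ _ (mtop l) (mtop r) (ctop u) (ctop c).
Proof.
rewrite /zigzag_l /= !ctop_cast.
do !congr vcomp; rewrite /eqcell; congr cast_id; exact: proof_irrelevance.
Qed.

Lemma ctop_zigzag_r :
  ctop (zigzag_r u c) = @zigzag_r K _ _ (mtop l) (mtop r) (ctop u) (ctop c).
Proof.
rewrite /zigzag_r /= !ctop_cast.
do !congr vcomp; rewrite /eqcell; congr cast_id; exact: proof_irrelevance.
Qed.

Lemma cbase_zigzag_l :
  cbase (zigzag_l u c) = @zigzag_l K _ _ (mbase l) (mbase r) (cbase u) (cbase c).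
Proof.
rewrite /zigzag_l /= !cbase_cast.
do !congr vcomp; rewrite /eqcell; congr cast_id; exact: proof_irrelevance.
Qed.

Lemma cbase_zigzag_r :
  cbase (zigzag_r u c) = @zigzag_r K _ _ (mbase l) (mbase r) (cbase u) (cbase c).
Proof.
rewrite /zigzag_r /= !cbase_cast.
do !congr vcomp; rewrite /eqcell; congr cast_id; exact: proof_irrelevance.
Qed.

End Projections.

(** Kept transparent: its unit and counit must reduce to top components for [underlies] to hold by
    [erefl]. *)
Definition top_adjunction (K : two_category) (a b : arrow_two_category K)
    (l : a ~> b) (r : b ~> a) (A : adjunction l r) :
    @adjunction K (top a) (top b) (mtop l) (mtop r).
Proof.
refine (@Adjunction K _ _ (mtop l) (mtop r)
  (ctop (adj_unit A)) (ctop (adj_counit A)) _ _).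
- by rewrite -[LHS]ctop_zigzag_l [zigzag_l _ _]triangle_l.
- by rewrite -[LHS]ctop_zigzag_r [zigzag_r _ _]triangle_r.
Defined.

(** * The comprehension 2-cell determined by a counit *)

Section Comprehension.
Context (K : two_category) (E B : K) (p : E ~> B).
Context (s : section_of p) (r : E ~> B).

Lemma section_bracket : r = p ** (sec s ** r).
Proof. by rewrite comp1A secP comp1Il. Qed.

Definition counit_iota (eps : sec s ** r ==> id1 E) : r ==> p :=
  eqcell section_bracket ;; (p *< eps) ;; eqcell (comp1Ir p).

Lemma ceq_counit_iota (eps : sec s ** r ==> id1 E) :
  ceq (counit_iota eps) (p *< eps).
Proof. by apply: ceq_trans (ceq_castr _ _) _; apply: ceq_castl. Qed.

Lemma ceq_mcell_comprehension (i : r ==> p) :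
  ceq (mcell (comprehension_mor (Comprehension i))) i.
Proof. by apply: ceq_trans (ceq_castr _ _) _; apply: ceq_castl. Qed.

(** The cell of [section_mor s] is an identity, so pasting with it leaves only [i]. *)
Lemma ceq_mcell_counit (i : r ==> p) :
  ceq (mcell (acomp (section_mor s) (comprehension_mor (Comprehension i)))) i.
Proof.
apply: ceq_trans (ceq_acomp _ _) _; rewrite /vcompc -vcompA.
apply: ceq_trans.
  by apply: ceq_identityl; apply: is_identity_whiskr; apply: is_identity_eqcell.
apply: ceq_trans (ceq_castl _ _) _.
apply: ceq_trans (ceq_hcompIl _) _; exact: ceq_mcell_comprehension.
Qed.

Lemma ceq_mcell_unit (i : r ==> p) :
  ceq (mcell (acomp (comprehension_mor (Comprehension i)) (section_mor s)))
    (i >* sec s).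
Proof.
apply: ceq_trans (ceq_acomp _ _) _; rewrite /vcompc.
apply: ceq_trans.
  by apply: ceq_identityr; apply: is_identity_whiskl; apply: is_identity_eqcell.
apply: ceq_trans (ceq_castr _ _) _.
exact: ceq_hcomp (ceq_mcell_comprehension _) (ceq_refl _).
Qed.

(** Up to identities, [ccell c] is an equation between [i] and [p *< ctop c]; this gives the
    uniqueness of the comprehension 2-cell. *)
Lemma iota_of_counit (i : r ==> p)
  (c : acell (acomp (section_mor s) (comprehension_mor (Comprehension i)))
         (aid1 (arrow_of p))) :
  is_identity (cbase c) -> i = counit_iota (ctop c).
Proof.
move=> ic; apply: eq_of_ceq.
apply: ceq_trans (ceq_sym (ceq_mcell_counit i)) _.
apply: ceq_trans (ceq_sym (ceq_identityr _ (is_identity_whiskr p ic))) _.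
apply: ceq_trans (ceq_of_eq (ccell c)) _.
apply: ceq_trans (ceq_castr _ _) _; exact/ceq_sym/ceq_counit_iota.
Qed.

(** * Lift of an adjunction from K to K//K *)

Context (A : adjunction (sec s) r).

Let i := counit_iota (adj_counit A).
Let l' := section_mor s.
Let r' := comprehension_mor (Comprehension i).

Lemma lifted_counit_subproof :
  mcell (acomp l' r') ;; (eqcell (comp1Il (id1 B)) >* p) =
    (p *< adj_counit A) ;; mcell (aid1 (arrow_of p)).
Proof.
apply: eq_of_ceq.
apply: ceq_trans.
  by apply: ceq_identityr; apply: is_identity_whiskr; apply: is_identity_eqcell.
apply: ceq_trans (ceq_mcell_counit _) _.
apply: ceq_trans (ceq_counit_iota _) _.
exact/ceq_sym/ceq_castr.
Qed.

(** Since [p ** sec s] is the identity, whiskering by [id1 B] splits through [sec s], which exposes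
    the unit factor of [triangle_l]. *)
Lemma ceq_whisk_unit : ceq (id1 B *< adj_unit A) (p *< (sec s *< adj_unit A)).
Proof.
apply: ceq_sym; apply: ceq_trans (ceq_hcompA _ _ _) _.
apply: ceq_hcomp; last exact: ceq_refl.
by rewrite hcomp_id secP; apply: ceq_refl.
Qed.

Lemma lifted_unit_subproof :
  mcell (aid1 (arrow_id B)) ;; (eqcell (esym (comp1Il (id1 B))) >* id1 B) =
    (id1 B *< adj_unit A) ;; mcell (acomp r' l').
Proof.
apply: eq_of_ceq.
apply: ceq_trans (ceq_castl _ _) _.
apply: ceq_trans.
  (* The 1-cell [p ** sec s] is chosen so that its identity is [p *< id2 (sec s)], the image under
     [p] of the right side of [triangle_l]. *)
  apply: (@ceq_is_identity K B B _ _ (p ** sec s)); last by rewrite secP comp1Il.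
  by apply: is_identity_whiskr; apply: is_identity_eqcell.
apply: ceq_sym.
(* The image under [p] of the associativity cast that separates unit and counit in [triangle_l]. *)
set e := f_equal (comp1 p) (comp1A (sec s) r (sec s)).
apply: (@ceq_trans K B B _ _ _ _ _ _ _
  (vcompc e (p *< (sec s *< adj_unit A)) (p *< (adj_counit A >* sec s)))).
  rewrite -[X in ceq X _]vcompc_refl.
  apply: ceq_vcompc; first exact: ceq_whisk_unit.
  apply: ceq_trans (ceq_mcell_unit _) _.
  apply: ceq_trans (ceq_hcomp (ceq_counit_iota _) (ceq_refl _)) _.
  exact/ceq_sym/ceq_hcompA.
rewrite -whisk_vcompc -hcomp_id.
apply: ceq_hcomp; first exact: ceq_refl.
(* Only the two outer unit casts of [triangle_l] remain to be stripped. *)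
apply: ceq_sym; apply: ceq_trans (ceq_of_eq (esym (triangle_l A))) _.
apply: ceq_trans (ceq_castr _ _) _; rewrite -!vcompA.
apply: ceq_trans (ceq_castl _ _) _; rewrite /vcompc vcompA.
exact: ceq_refl.
Qed.

Definition lifted_unit : acell (aid1 (arrow_id B)) (acomp r' l') :=
  @ACell K (arrow_id B) (arrow_id B) (aid1 (arrow_id B)) (acomp r' l')
    (adj_unit A) (eqcell (esym (comp1Il (id1 B)))) lifted_unit_subproof.

Definition lifted_counit : acell (acomp l' r') (aid1 (arrow_of p)) :=
  @ACell K (arrow_of p) (arrow_of p) (acomp l' r') (aid1 (arrow_of p))
    (adj_counit A) (eqcell (comp1Il (id1 B))) lifted_counit_subproof.

(** Equations of 2-cells are tested on components: the top ones are the triangles of [A], the base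
    ones are composites of identities. *)
Definition lifted_adjunction : adjunction l' r'.
Proof.
refine (@Adjunction (arrow_two_category K) _ _ l' r' lifted_unit lifted_counit
  _ _); apply: acell_eq.
- by rewrite [LHS]ctop_zigzag_l; apply: triangle_l.
- rewrite [LHS]cbase_zigzag_l; apply: is_identity_zigzag_l;
    exact: is_identity_eqcell.
- by rewrite [LHS]ctop_zigzag_r; apply: triangle_r.
- rewrite [LHS]cbase_zigzag_r; apply: is_identity_zigzag_r;
    exact: is_identity_eqcell.
Defined.

End Comprehension.

(** * The correspondence between the two structures *)

Lemma underlies_fun (K : two_category) (E B : K) (p : E ~> B)
  (X : comprehension_adjoint_to_section p) (Y Y' : comprehension_with_section p) :
  underlies X Y -> underlies X Y' -> Y = Y'.
Proof.
case=> [tl [tr ->]] [tl' [tr' ->]].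
by rewrite (proof_irrelevance _ tl tl') (proof_irrelevance _ tr tr').
Qed.

(** The types of [A] and [A'] involve [i] and [i'], but the boundaries of the component 2-cells do
    not, so these can be compared without transport. *)
Lemma cas_eq (K : two_category) (E B : K) (p : E ~> B) (s : section_of p)
  (r : E ~> B) (i i' : r ==> p)
  (A : adjunction (section_mor s) (comprehension_mor (Comprehension i)))
  (A' : adjunction (section_mor s) (comprehension_mor (Comprehension i'))) :
  i = i' ->
  ctop (adj_unit A) = ctop (adj_unit A') ->
  ctop (adj_counit A) = ctop (adj_counit A') ->
  cbase (adj_unit A) = cbase (adj_unit A') ->
  cbase (adj_counit A) = cbase (adj_counit A') ->
  ComprehensionAdjointToSection A = ComprehensionAdjointToSection A'.
Proof.
move=> ei; destruct ei => ut ct ub cb; congr ComprehensionAdjointToSection.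
by apply: adjunction_eq; apply: acell_eq.
Qed.

Theorem proposition17 (K : two_category) (E B : K) (p : E ~> B) :
  (forall X : comprehension_adjoint_to_section p,
     exists! Y : comprehension_with_section p, underlies X Y) /\
  (forall Y : comprehension_with_section p,
     exists! X : comprehension_adjoint_to_section p,
       vertical X /\ underlies X Y).
Proof.
split=> [X | Y].
  pose A := top_adjunction (cas_adj X).
  exists (ComprehensionWithSection A); have XA : underlies X _ :=
    ex_intro _ (triangle_l A) (ex_intro _ (triangle_r A) erefl).
  by split=> // Y'; apply: underlies_fun.
exists (ComprehensionAdjointToSection (lifted_adjunction (cws_adj Y))); split.
  split; first by split; apply: is_identity_eqcell.
  by case: Y => s r [u c tl tr]; exists tl, tr.
(* For uniqueness, [underlies] fixes the top components, verticality fixes the base ones, and the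
   counit then fixes [i]. *)
case=> s [r i] A [[/= iu ic] [tl [tr ->]]] /=.
apply: cas_eq => //=; first exact/esym/iota_of_counit.
  by apply: is_identity_eq iu; apply: is_identity_eqcell.
by apply: is_identity_eq ic; apply: is_identity_eqcell.
Qed.
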